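(* Let $\langle A,\prec\rangle$ be an S4-subordination algebra and let $\langle X,\tau,\tau_S\rangle$ be its dual S4-subordination space. Then: (1) The following conditions are equivalent: (a) $\langle A,\prec\rangle$ is an S5-subordination algebra; (b) for all $U,V\in\mathrm{Clop}(X)$: $U\subseteq\mathrm{int}_S(V)$ iff $\mathrm{cl}_S(U)\subseteq V$; (c) the relation $\triangleleft_S$ is symmetric. (2) For every $a\in A$ with $a\neq 0$ there exists $b\in A$ with $b\neq 0$ and $b\prec a$, if and only if $\mathrm{int}_S(U)\neq\emptyset$ for each $U\in\mathrm{Clop}(X)\setminus\{\emptyset\}$.
   Context: A subordination on a Boolean algebra $A$ is a binary relation $\prec$ on $A$ such that: (S1) $0\prec 0$ and $1\prec 1$; (S2) $a\prec b$ and $a\prec c$ imply $a\prec b\wedge c$; (S3) $a\prec c$ and $b\prec c$ imply $a\vee b\prec c$; (S4) $a\leq b\prec c\leq d$ implies $a\prec d$. The pair $\langle A,\prec\rangle$ is an S4-subordination algebra if moreover (S5) $a\prec b$ implies $a\leq b$, and (S6) $a\prec b$ implies that there is $c\in A$ with $a\prec c\prec b$. It is an S5-subordination algebra if in addition (S7) $a\prec b$ implies $\neg b\prec\neg a$. The dual space $\langle X,\tau,\tau_S\rangle$ of an S4-subordination algebra $\langle A,\prec\rangle$ is: $X=\mathrm{Ul}(A)$, the set of ultrafilters of $A$; $\tau$ is the Stone topology with base $\{\varphi(a):a\in A\}$, $\varphi(a)=\{x\in X:a\in x\}$; $\tau_S$ is the topology with base the sets $\beta({\downarrow}a)=\{x\in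 X:x\cap{\downarrow}a\neq\emptyset\}$, $a\in A$, where ${\downarrow}a=\{b\in A:b\prec a\}$. $\mathrm{Clop}(X)$ is the set of clopen subsets of $\langle X,\tau\rangle$; $\mathrm{int}_S$ and $\mathrm{cl}_S$ denote interior and closure with respect to $\tau_S$. For $x,y\in X$, $x\triangleleft_S y$ iff for all $U\in\mathrm{Clop}(X)$, $x\in\mathrm{int}_S(U)$ implies $y\in U$. *)

(* Defs.v *)
From HB Require Import structures.
From mathcomp Require Import all_boot all_order.
From mathcomp Require Import boolp classical_sets topology_structure.

Set Implicit Arguments.
Unset Strict Implicit.
Unset Printing Implicit Defensive.

Import Order.Theory.
Local Open Scope classical_set_scope.
Local Open Scope order_scope.

Section Subordination.
Context {d : Order.disp_t} {A : ctbDistrLatticeType d}.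
Implicit Types prec : A -> A -> Prop.

Record subordination prec : Prop := Subordination {
  prec_bot : prec \bot \bot;
  prec_top : prec \top \top;
  prec_meet : forall a b c, prec a b -> prec a c -> prec a (b `&` c);
  prec_join : forall a b c, prec a c -> prec b c -> prec (a `|` b) c;
  prec_mono : forall a b c e, a <= b -> prec b c -> c <= e -> prec a e
}.

Record S4_subordination prec : Prop := S4Subordination {
  S4_subord :> subordination prec;
  prec_le : forall a b, prec a b -> a <= b;
  prec_interp : forall a b, prec a b -> exists c, prec a c /\ prec c b
}.

Record S5_subordination prec : Prop := S5Subordination {
  S5_S4 :> S4_subordination prec;
  prec_compl : forall a b, prec a b -> prec (~` b) (~` a)
}.

Record proper_filter (F : set A) : Prop := ProperFilter {
  filter_top : F \top;
  filter_meet : forall a b, F a -> F b -> F (a `&` b);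
  filter_up : forall a b, a <= b -> F a -> F b;
  filter_proper : ~ F \bot
}.

Definition ultrafilter : set (set A) :=
  [set x | proper_filter x /\
     forall G : set A, proper_filter G -> x `<=` G -> G = x].

Lemma ultrafilter_filter (x : ultrafilter) : proper_filter (val x).
Proof. by have /set_mem[] := valP x. Qed.

Definition stone_map (a : A) : set ultrafilter := [set x | val x a].

Definition down prec (a : A) : set A := [set b | prec b a].

Definition subord_map prec (a : A) : set ultrafilter :=
  [set x | val x `&` down prec a !=set0].

(* [isBaseTopological] wants a pointed index type, which [A] is not, so each
   base is indexed by its own members. *)
Lemma stone_map_cover :
  \bigcup_(U in range stone_map) idfun U = [set: ultrafilter].
Proof.
apply/seteqP; split=> // x _; exists (stone_map \top); first by exists \top.
exact: filter_top (ultrafilter_filter x).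
Qed.

Lemma stone_map_join (U V : set ultrafilter) (x : ultrafilter) :
  range stone_map U -> range stone_map V -> idfun U x -> idfun V x ->
  exists W, [/\ range stone_map W, idfun W x & idfun W `<=` idfun U `&` idfun V].
Proof.
move=> [a _ <-] [b _ <-] xa xb; exists (stone_map (a `&` b)); split.
- by exists (a `&` b).
- exact: filter_meet (ultrafilter_filter x) _ _ xa xb.
- move=> y yab; split; apply: (filter_up (ultrafilter_filter y) _ yab).
    exact: leIl.
  exact: leIr.
Qed.

Lemma subord_map_cover prec : subordination prec ->
  \bigcup_(U in range (subord_map prec)) idfun U = [set: ultrafilter].
Proof.
move=> h; apply/seteqP; split=> // x _.
exists (subord_map prec \top); first by exists \top.
exists \top; split; first exact: filter_top (ultrafilter_filter x).
exact: prec_top h.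
Qed.

Lemma subord_map_join prec (h : subordination prec)
    (U V : set ultrafilter) (x : ultrafilter) :
  range (subord_map prec) U -> range (subord_map prec) V ->
  idfun U x -> idfun V x ->
  exists W, [/\ range (subord_map prec) W, idfun W x &
    idfun W `<=` idfun U `&` idfun V].
Proof.
move=> [a _ <-] [b _ <-] [u [xu ua]] [v [xv vb]].
exists (subord_map prec (a `&` b)); split.
- by exists (a `&` b).
- exists (u `&` v); split.
    exact: filter_meet (ultrafilter_filter x) _ _ xu xv.
  apply: (prec_meet h).
    exact: prec_mono h _ _ _ _ (leIl _ _) ua (lexx _).
  exact: prec_mono h _ _ _ _ (leIr _ _) vb (lexx _).
- move=> y [w [yw wab]]; split; exists w; split=> //.
    exact: prec_mono h _ _ _ _ (lexx _) wab (leIl _ _).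
  exact: prec_mono h _ _ _ _ (lexx _) wab (leIr _ _).
Qed.

End Subordination.

(* The two topologies of the dual space live on two aliases of the type of
   ultrafilters; [prec] and the proof of its axioms are parameters of the
   second alias only so that its topology can be found by inference. *)
Definition stone_space d (A : ctbDistrLatticeType d) : Type :=
  @ultrafilter d A.

Definition subord_space d (A : ctbDistrLatticeType d) (prec : A -> A -> Prop)
  (h : S4_subordination prec) : Type := @ultrafilter d A.

Section DualSpace.
Context {d : Order.disp_t} {A : ctbDistrLatticeType d}.

HB.instance Definition _ := Choice.on (stone_space A).
HB.instance Definition _ := isBaseTopological.Build (stone_space A)
  (@stone_map_cover d A) (@stone_map_join d A).

Context (prec : A -> A -> Prop) (h : S4_subordination prec).

HB.instance Definition _ := Choice.on (subord_space h).
HB.instance Definition _ := isBaseTopological.Build (subord_space h)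
  (subord_map_cover h) (@subord_map_join d A prec h).

Definition intS (U : set (stone_space A)) : set (stone_space A) :=
  interior (U : set (subord_space h)).

Definition clS (U : set (stone_space A)) : set (stone_space A) :=
  closure (U : set (subord_space h)).

Definition triS (x y : stone_space A) : Prop :=
  forall U : set (stone_space A), clopen U -> intS U x -> U y.

End DualSpace.

(* Main.v *)
Require Import Defs.
From HB Require Import structures.
From mathcomp Require Import all_boot all_order.
From mathcomp Require Import boolp classical_sets topology_structure.

Set Implicit Arguments.
Unset Strict Implicit.
Unset Printing Implicit Defensive.

Local Open Scope classical_set_scope.
Local Open Scope order_scope.

Import Order.Theory.

(** The whole statement is Stone duality followed by a reading in [A].

    The topological side is translated by three facts.  Every clopen set of
    the Stone space is [stone_map a] for some [a] ([clopen_stone_map]);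
    the [tau_S]-interior of [stone_map a] is the basic open set
    [subord_map prec a] ([intS_stone_map]); and
    [stone_map a `<=` subord_map prec b] holds exactly when [prec a b]
    ([stone_map_sub_subord_map]).  Since complementation exchanges closures
    and interiors, [clS (stone_map a) `<=` stone_map b] then says that
    [prec (~` b) (~` a)], so condition (b) is (S7) together with the converse
    implication, which is (S7) again because complementation is an involution.

    In the same dictionary [triS x y] says that everything lying [prec]-above
    a member of [x] belongs to [y].  Under (S7) symmetry is immediate by
    taking complements.  If [prec a b] but not [prec (~` b) (~` a)], two
    applications of the separation theorem give [x] containing [~` b] but
    nothing [prec]-below [~` a], then [y] containing [a] with [triS x y];
    symmetry would put [b] in [x].

    Part (2) holds because [subord_map prec a] is nonempty exactly when [prec] has
    a nonzero element below [a].

    Each of these facts needs enough ultrafilters, in the form of the separation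
    of a meet-closed set from a join-closed one ([ultrafilter_separation]),
    which rests on Zorn's lemma. *)

(** * Ultrafilters of a Boolean algebra *)

Section Ultrafilters.
Context {d : Order.disp_t} {A : ctbDistrLatticeType d}.

Lemma proper_filter_ultrafilter (F : set A) :
  proper_filter F -> exists x : @ultrafilter d A, F `<=` val x.
Proof.
move=> hF.
(* Zorn is applied to the sets [X] whose union with [F] is a proper filter,
   rather than to the proper filters above [F], so that the union of the empty
   chain qualifies. *)
pose P : set (set A) := fun X => proper_filter (X `|` F)%classic.
have [|M [hM maxM]] := @Zorn_bigcup A P.
  move=> C CP Ctot.
  have inC X c : C X -> (X `|` F)%classic c ->
      ((\bigcup_(Y in C) Y) `|` F)%classic c.
    by move=> CX [Xc|Fc]; [left; exists X|right].
  split.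
  - by right; exact: filter_top hF.
  - move=> a b [[X CX Xa]|Fa] [[Y CY Yb]|Fb].
    + have [XY|YX] := Ctot _ _ CX CY.
        apply: inC (CY) _; apply: filter_meet (CP _ CY) _ _ _ _; left=> //.
        exact: XY.
      apply: inC (CX) _; apply: filter_meet (CP _ CX) _ _ _ _; left=> //.
      exact: YX.
    + apply: inC (CX) _.
      exact: filter_meet (CP _ CX) _ _ (or_introl Xa) (or_intror Fb).
    + apply: inC (CY) _.
      exact: filter_meet (CP _ CY) _ _ (or_intror Fa) (or_introl Yb).
    + by right; exact: filter_meet hF _ _ Fa Fb.
  - move=> a b ab [[X CX Xa]|Fa].
      by apply: inC (CX) _; exact: filter_up (CP _ CX) _ _ ab (or_introl Xa).
    by right; exact: filter_up hF _ _ ab Fa.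
  - move=> [[X CX X0]|F0]; last exact: filter_proper hF F0.
    exact: filter_proper (CP _ CX) (or_introl X0).
have uM : ultrafilter (M `|` F)%classic.
  split=> // G hG MFG; apply/seteqP; split=> // a Ga; left.
  apply: contrapT => nMa; apply: (maxM G); first split.
  - by move=> b Mb; apply: MFG; left.
  - by move=> /(_ a Ga).
  - suff -> : P G = proper_filter G by [].
    by congr proper_filter; apply/setUidPl => b Fb; apply: MFG; right.
by exists (SigSub (mem_set uM)) => a Fa; right.
Qed.

(** The witness is the filter generated by the meets of a member of [F] with
    the complement of a member of [J]; such a meet is [\bot] only when the
    former lies below the latter. *)
Lemma proper_filter_separation (F J : set A) :
  F \top -> (forall a b, F a -> F b -> F (a `&` b)) ->
  J \bot -> (forall a b, J a -> J b -> J (a `|` b)) ->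
  (forall a b, F a -> J b -> ~ a <= b) ->
  exists G : set A, [/\ proper_filter G, F `<=` G & forall b, J b -> G (~` b)].
Proof.
move=> F1 FI J0 JU FJ.
exists (fun c => exists f j, [/\ F f, J j & f `&` ~` j <= c]); split.
- split.
  + by exists \top, \bot; rewrite lex1.
  + move=> a b [f [j [Ff Jj fja]]] [g [k [Fg Jk gkb]]].
    exists (f `&` g), (j `|` k); split; [exact: FI|exact: JU|].
    by rewrite complU meetACA leI2.
  + move=> a b ab [f [j [Ff Jj fja]]].
    by exists f, j; split=> //; exact: le_trans ab.
  + move=> [f [j [Ff Jj]]]; rewrite lex0 disj_leC complK.
    exact: FJ.
- by move=> f Ff; exists f, \bot; rewrite leIl.
- by move=> j Jj; exists \top, j; rewrite meet1x.
Qed.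

(** Maximality makes [x] equal to the filter generated by [x] and [~` a],
    which is proper as soon as [a] is not in [x]. *)
Lemma ultrafilterC (x : @ultrafilter d A) (a : A) : val x (~` a) <-> ~ val x a.
Proof.
have hx := ultrafilter_filter x; split=> [xNa xa|nxa].
  by apply: (filter_proper hx); rewrite -(meetxC a); exact: filter_meet hx _ _ xa xNa.
have [_ maxx] := set_mem (valP x).
have [|||||G [hG xG GN]] := @proper_filter_separation (val x) [set b | b <= a].
- exact: filter_top hx.
- exact: filter_meet hx.
- by rewrite /= le0x.
- by move=> b c /= ba ca; rewrite leUx ba.
- move=> b c xb /= ca bc; apply: nxa.
  exact: filter_up hx _ _ (le_trans bc ca) xb.
by rewrite -(maxx G hG xG); apply: GN => /=.
Qed.

Lemma ultrafilter_prime (x : @ultrafilter d A) (a b : A) :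
  val x (a `|` b) -> val x a \/ val x b.
Proof.
have hx := ultrafilter_filter x => xab.
have [|nxa] := pselect (val x a); first by left.
right; have xNa : val x (~` a) by exact/ultrafilterC.
apply: filter_up hx _ _ _ (filter_meet hx xab xNa).
by rewrite meetUl meetxC join0x leIl.
Qed.

Lemma ultrafilter_separation (F J : set A) :
  F \top -> (forall a b, F a -> F b -> F (a `&` b)) ->
  J \bot -> (forall a b, J a -> J b -> J (a `|` b)) ->
  (forall a b, F a -> J b -> ~ a <= b) ->
  exists x : @ultrafilter d A, F `<=` val x /\ forall b, J b -> ~ val x b.
Proof.
move=> F1 FI J0 JU FJ.
have [G [hG FG GN]] := proper_filter_separation F1 FI J0 JU FJ.
have [x Gx] := proper_filter_ultrafilter hG.
exists x; split=> [f Ff|j Jj]; first exact/Gx/FG.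
exact/ultrafilterC/Gx/GN.
Qed.

Lemma ultrafilter_separation1 (a : A) (J : set A) :
  J \bot -> (forall b c, J b -> J c -> J (b `|` c)) ->
  (forall b, J b -> ~ a <= b) ->
  exists x : @ultrafilter d A, val x a /\ forall b, J b -> ~ val x b.
Proof.
move=> J0 JU aJ.
have [|||x [ax xJ]] := @ultrafilter_separation [set b | a <= b] J _ _ J0 JU.
- by rewrite /= lex1.
- by move=> b c /= ab ac; rewrite lexI ab.
- by move=> b c /= ab Jc bc; apply: aJ Jc _; exact: le_trans bc.
by exists x; split=> //; apply: ax => /=.
Qed.

Lemma stone_map_nonempty (a : A) : a <> \bot -> exists x, stone_map a x.
Proof.
move=> a0; have [| | |x [xa _]] := @ultrafilter_separation1 a [set \bot].
- by [].
- by move=> _ _ -> ->; rewrite joinxx.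
- by move=> _ -> /=; rewrite lex0 => /eqP.
by exists x.
Qed.

Lemma stone_mapC (a : A) : stone_map (~` a) = (~` stone_map a)%classic.
Proof. by apply/seteqP; split=> x /ultrafilterC. Qed.

Lemma stone_map_le (a b : A) : stone_map a `<=` stone_map b -> a <= b.
Proof.
move=> ab; apply: contrapT => nab.
have [| | |x [xa xb]] := @ultrafilter_separation1 a [set c | c <= b].
- by rewrite /= le0x.
- by move=> c e /= cb eb; rewrite leUx cb.
- by move=> c /= cb ac; apply: nab; exact: le_trans cb.
by apply: (xb b) => /=; [|exact: ab].
Qed.

End Ultrafilters.

(** * The dual space *)

Section StoneSpace.
Context {d : Order.disp_t} {A : ctbDistrLatticeType d}.

Lemma open_stone_mapP (U : set (stone_space A)) (x : stone_space A) :
  open U -> U x -> exists2 a, stone_map a x & stone_map a `<=` U.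
Proof.
move=> [D DB <-] [V DV Vx]; have [a _ aV] := DB _ DV.
by exists a; rewrite aV // => y Vy; exists V.
Qed.

Lemma open_stone_map (a : A) : open (stone_map a : set (stone_space A)).
Proof.
exists [set stone_map a]; first by move=> _ ->; exists a.
by rewrite bigcup_set1.
Qed.

(** Compactness is replaced by a single separation.  The [a] with
    [stone_map a] inside [U], and the [b] with [stone_map b] inside its
    complement, form two ideals.  If [a `|` b] is [\top] for some such pair,
    then [U] is [stone_map a].  Otherwise some ultrafilter avoids both ideals,
    which is absurd: it lies in one of the open sets [U] and [~` U], hence in a
    basic open subset of it. *)
Lemma clopen_stone_map (U : set (stone_space A)) :
  clopen U <-> exists a, U = stone_map a.
Proof.
split=> [[oU cU]|[a ->]]; last first.
  split; first exact: open_stone_map.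
  rewrite -openC -stone_mapC; exact: open_stone_map.
have ideal (V : set (stone_space A)) (a b : A) : stone_map a `<=` V ->
    stone_map b `<=` V -> stone_map (a `|` b) `<=` V.
  by move=> aV bV x /ultrafilter_prime[/aV|/bV].
have stone0 (V : set (stone_space A)) : stone_map \bot `<=` V.
  by move=> x /(filter_proper (ultrafilter_filter x)).
have [[a [b [aU bU ab]]]|nab] := pselect (exists a b,
    [/\ stone_map a `<=` U, stone_map b `<=` (~` U)%classic & \top <= a `|` b]).
  exists a; apply/seteqP; split=> // x Ux.
  have hx := ultrafilter_filter x.
  by have [|//|/bU] := @ultrafilter_prime _ _ x a b;
    first exact: filter_up hx _ _ ab (filter_top hx).
have [| | |x [_ xJ]] := @ultrafilter_separation1 _ A \top
    [set c | exists a b, [/\ stone_map a `<=` U,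
      stone_map b `<=` (~` U)%classic & c = a `|` b]].
- by exists \bot, \bot; rewrite joinxx.
- move=> _ _ [a [b [aU bU ->]]] [a' [b' [a'U b'U ->]]].
  exists (a `|` a'), (b `|` b'); split; [exact: ideal|exact: ideal|].
  by rewrite joinACA.
- by move=> _ [a [b [aU bU ->]]] ab; apply: nab; exists a, b.
have [Ux|nUx] := pselect (U x).
  have [a xa aU] := open_stone_mapP oU Ux.
  by case: (xJ a) => //; exists a, \bot; rewrite joinx0.
have [b xb bU] := open_stone_mapP (closed_openC cU) nUx.
by case: (xJ b) => //; exists \bot, b; rewrite join0x.
Qed.

End StoneSpace.

Section DualSpace.
Context {d : Order.disp_t} {A : ctbDistrLatticeType d}.
Context (prec : A -> A -> Prop) (h : S4_subordination prec).

(** If [subord_map prec a] lies inside [stone_map b], interpolation makes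
    everything [prec]-below [a] also [prec]-below [b]: from [prec c e] and
    [prec e a] one gets [e <= b]. *)
Lemma intS_stone_map (b : A) : intS h (stone_map b) = subord_map prec b.
Proof.
have mono := prec_mono h.
have sub (e a : A) : prec e a -> stone_map e `<=` subord_map prec a.
  by move=> ea x xe; exists e.
apply/seteqP; split=> x.
  rewrite /intS /interior nbhsE => -[_ [[D DB <-]]] [V DV Vx] DbB.
  have [a _ aV] := DB _ DV; move: Vx; rewrite -aV => -[c [xc ca]].
  have [e [ce ea]] := prec_interp h ca.
  exists c; split=> //; apply: mono (lexx _) ce _.
  by apply: stone_map_le => y ye; apply: DbB; exists V => //; rewrite -aV; exact: sub ea y ye.
move=> xb; rewrite /intS /interior nbhsE; exists (subord_map prec b).
  split=> //; exists [set subord_map prec b]; last by rewrite bigcup_set1.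
  by move=> _ ->; exists b.
move=> y [c [yc cb]].
exact: filter_up (ultrafilter_filter y) _ _ (prec_le h cb) yc.
Qed.

Lemma clS_stone_map (a : A) :
  clS h (stone_map a) = (~` subord_map prec (~` a)%O)%classic.
Proof.
rewrite -intS_stone_map stone_mapC.
by have := @closure_setC (subord_space h) (~` stone_map a)%classic; rewrite setCK.
Qed.

(** When [prec a b] fails, [a] is below nothing in the ideal of elements
    [prec]-below [b]; an ultrafilter separates the two. *)
Lemma stone_map_sub_subord_map (a b : A) :
  stone_map a `<=` subord_map prec b <-> prec a b.
Proof.
split=> [ab|ab x xa]; last by exists a.
apply: contrapT => nab.
have [| | |x [xa xb]] := @ultrafilter_separation1 _ _ a [set c | prec c b].
- exact: prec_mono h _ _ _ _ (lexx _) (prec_bot h) (le0x _).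
- by move=> c e; exact: prec_join h _ _ _.
- by move=> c cb ac; apply: nab; exact: prec_mono h _ _ _ _ ac cb (lexx _).
by have [c [xc cb]] := ab _ xa; apply: xb cb xc.
Qed.

Lemma clS_stone_map_sub (a b : A) :
  clS h (stone_map a) `<=` stone_map b <-> prec (~` b) (~` a).
Proof.
rewrite -stone_map_sub_subord_map clS_stone_map stone_mapC.
by split; [move=> /subsetC; rewrite setCK|move=> /subsetC; rewrite setCK].
Qed.

Lemma triS_prec (x y : stone_space A) :
  triS h x y <-> forall a b, prec a b -> val x a -> val y b.
Proof.
split=> [xy a b ab xa|xy U /clopen_stone_map[b ->]].
  apply: (xy (stone_map b)); first by apply/clopen_stone_map; exists b.
  by rewrite intS_stone_map; exists a.
by rewrite intS_stone_map => -[a [xa ab]]; exact: xy ab xa.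
Qed.

(** * The correspondence *)

Lemma S5_clS :
  S5_subordination prec <->
  (forall U V : set (stone_space A), clopen U -> clopen V ->
     (U `<=` intS h V <-> clS h U `<=` V)).
Proof.
split=> [s5 _ _ /clopen_stone_map[a ->] /clopen_stone_map[b ->]|UV].
  rewrite intS_stone_map stone_map_sub_subord_map clS_stone_map_sub.
  split; first exact: prec_compl.
  by move=> /(prec_compl s5); rewrite !complK.
split=> // a b ab; apply/clS_stone_map_sub/UV.
- by apply/clopen_stone_map; exists a.
- by apply/clopen_stone_map; exists b.
- by rewrite intS_stone_map stone_map_sub_subord_map.
Qed.

Lemma triS_sym_of_S5 : S5_subordination prec ->
  forall x y : stone_space A, triS h x y -> triS h y x.
Proof.
move=> s5 x y /triS_prec xy; apply/triS_prec => a b ab ya.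
apply: contrapT => /ultrafilterC xNb.
exact: (ultrafilterC y a).1 (xy _ _ (prec_compl s5 ab) xNb) ya.
Qed.

(** A failure of (S7) at [prec a b] yields [x] and [y] with [triS x y], with [a]
    in [y] and [~` b] in [x].  Such a pair breaks symmetry, as [triS y x] would
    send [a] in [y] to [b] in [x]. *)
Lemma S5_of_triS_sym :
  (forall x y : stone_space A, triS h x y -> triS h y x) ->
  S5_subordination prec.
Proof.
have mono := prec_mono h.
move=> sym; split=> // a b ab; apply: contrapT => nNab.
have [x xNb xNa] : exists2 x, stone_map (~` b) x & ~ subord_map prec (~` a) x.
  apply: contrapT => nx; apply: nNab; apply/stone_map_sub_subord_map => x xNb.
  by apply: contrapT => xNa; apply: nx; exists x.
have hx := ultrafilter_filter x.
(* [y] contains every element [prec]-above a member of [x], whence [triS x y],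
   and avoids [~` a]. *)
have [| | | | |y [xy yNa]] := @ultrafilter_separation _ A
    [set f | exists2 e, val x e & prec e f] [set c | c <= ~` a].
- by exists \top; [exact: filter_top hx|exact: prec_top h].
- move=> f g [e xe ef] [e' xe' e'g]; exists (e `&` e').
    exact: filter_meet hx _ _ xe xe'.
  apply: (prec_meet h); first exact: mono (leIl _ _) ef (lexx _).
  exact: mono (leIr _ _) e'g (lexx _).
- by rewrite /= le0x.
- by move=> c e /= ca ea; rewrite leUx ca.
- move=> f c [e xe ef] /= ca fc; apply: xNa; exists e; split=> //.
  exact: mono (lexx _) ef (le_trans fc ca).
have /sym/triS_prec/(_ _ _ ab) : triS h x y.
  by apply/triS_prec => e f ef xe; apply: xy; exists e.
have ya : val y a by rewrite -(complK a); apply/ultrafilterC/yNa => /=.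
by move=> /(_ ya); exact/ultrafilterC.
Qed.

Lemma subord_map_nonempty (a : A) :
  (exists b, b <> \bot /\ prec b a) <-> exists x, subord_map prec a x.
Proof.
split=> [[b [b0 ba]]|[x [b [xb ba]]]].
  by have [x xb] := stone_map_nonempty b0; exists x, b.
exists b; split=> // b0.
by apply: (filter_proper (ultrafilter_filter x)); rewrite -b0.
Qed.

Lemma prec_dense_intS :
  (forall a : A, a <> \bot -> exists b : A, b <> \bot /\ prec b a) <->
  (forall U : set (stone_space A), clopen U -> U <> set0 -> intS h U <> set0).
Proof.
split=> [dense _ /clopen_stone_map[a ->] aneq0|nint a a0].
  have /dense/subord_map_nonempty[x xa] : a <> \bot.
    move=> a0; apply: aneq0; rewrite a0 -subset0 => x.
    exact: filter_proper (ultrafilter_filter x).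
  by rewrite intS_stone_map => /seteqP[/(_ x xa)].
apply/subord_map_nonempty; have [x xa] := stone_map_nonempty a0.
have clopa : clopen (stone_map a : set (stone_space A)).
  by apply/clopen_stone_map; exists a.
have /(nint _ clopa) : stone_map a <> set0 by move=> a0'; rewrite a0' in xa.
by rewrite intS_stone_map => /eqP/set0P.
Qed.

End DualSpace.

Theorem proposition13 (d : Order.disp_t) (A : ctbDistrLatticeType d)
    (prec : A -> A -> Prop) (h : S4_subordination prec) :
  ((S5_subordination prec <->
    (forall U V : set (stone_space A), clopen U -> clopen V ->
       (U `<=` intS h V <-> clS h U `<=` V)))
   /\
   (S5_subordination prec <->
    (forall x y : stone_space A, triS h x y -> triS h y x)))
  /\
  ((forall a : A, a <> \bot -> exists b : A, b <> \bot /\ prec b a) <->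
   (forall U : set (stone_space A), clopen U -> U <> set0 ->
      intS h U <> set0)).
Proof.
split; last exact: prec_dense_intS.
split; first exact: S5_clS.
by split; [exact: triS_sym_of_S5|exact: S5_of_triS_sym].
Qed.
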